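(* For any graph $G$ with line graph $L(G)$, we have \[ n^+(L(G)) \le \min\left\{3\,n^-(L(G)),\ \tfrac{1}{2}\,n^-(L(G))\left(n^-(L(G))+1\right)\right\}. \]
   Context: Graphs are finite and simple. For a graph $H$ with adjacency matrix $A(H)$, $n^+(H)$ and $n^-(H)$ denote the number of positive and negative eigenvalues of $A(H)$, respectively, counted with multiplicity (both are $0$ if $H$ has no vertices). The line graph $L(G)$ has the edges of $G$ as vertices, two distinct edges being adjacent when they share an endpoint. *)

(* Defs.v *)
From mathcomp Require Import all_boot all_order all_algebra all_field.

Set Implicit Arguments.
Unset Strict Implicit.
Unset Printing Implicit Defensive.

Import Order.TTheory GRing.Theory Num.Theory.
Local Open Scope ring_scope.

Record sgraph := SGraph {
  vertex :> finType;
  adj : rel vertex;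
  adj_sym : symmetric adj;
  adj_irrefl : irreflexive adj
}.

Definition edges (G : sgraph) : {set {set G}} :=
  [set E : {set G} | [exists x, exists y, adj x y && (E == [set x; y])]].

Definition edge (G : sgraph) : finType := {E : {set G} | E \in edges G}.

Definition line_adj (G : sgraph) : rel (edge G) :=
  fun E F => (E != F) && (val E :&: val F != set0).

Lemma line_adj_sym (G : sgraph) : symmetric (@line_adj G).
Proof. by move=> E F; rewrite /line_adj eq_sym setIC. Qed.

Lemma line_adj_irrefl (G : sgraph) : irreflexive (@line_adj G).
Proof. by move=> E; rewrite /line_adj eqxx. Qed.

Definition line_graph (G : sgraph) : sgraph :=
  SGraph (@line_adj_sym G) (@line_adj_irrefl G).

Definition adjmx (H : sgraph) : 'M[algC]_#|H| :=
  \matrix_(i, j) (adj (enum_val i) (enum_val j))%:R.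

(* The roots of the characteristic polynomial, each repeated according to its
   multiplicity (see [prod_eigenvalues]). *)
Definition eigenvalues n (A : 'M[algC]_n) : seq algC :=
  sval (closed_field_poly_normal (char_poly A)).

Lemma prod_eigenvalues n (A : 'M[algC]_n) :
  char_poly A = \prod_(z <- eigenvalues A) ('X - z%:P).
Proof.
rewrite /eigenvalues; case: closed_field_poly_normal => s /= {1}->.
by rewrite (monicP (char_poly_monic A)) scale1r.
Qed.

(* In algC, [0 < z] and [z < 0] each entail that z is real. *)
Definition npos (H : sgraph) : nat :=
  count (fun z : algC => 0 < z) (eigenvalues (adjmx H)).

Definition nneg (H : sgraph) : nat :=
  count (fun z : algC => z < 0) (eigenvalues (adjmx H)).

(* Main.v *)
Require Import Defs.
From mathcomp Require Import all_boot all_order all_algebra all_field.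
From mathcomp Require Import zify ring.

Import Order.TTheory GRing.Theory Num.Theory.
Local Open Scope ring_scope.

Set Implicit Arguments.
Unset Strict Implicit.
Unset Printing Implicit Defensive.

(* Let q be the quadratic form of the adjacency matrix A of L(G), let S be a
   maximum matching of G, i.e. a maximum stable set of L(G), and let J, a subset
   of S, index a basis of the rows S of A, with r = |J|. The coordinates in S
   span an isotropic space, so r <= n^-, and both n^+ - r and n^- - r are
   governed by q on the space Y of vectors supported off S and killed by the
   rows S of A.

   Each f outside S has one or two neighbours in S, and the set of these is
   determined by its trace on J, which is nonempty; so at most r(r+1)/2 sets of
   neighbours occur. If n^- = r, then q >= 0 on Y; for f, f' with the same
   neighbours, q(f - f') = - 2 A(f, f') <= 0, so q vanishes on the span of these
   differences, and n^+ is at most the number of classes, i.e. r(r+1)/2.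

   In general let m be the number of edges of S that have a neighbour, h the
   number of those with a neighbour that has no other neighbour in S, and w the
   number of unmatched vertices of degree at least 3. Since q(x) is the sum of
   |sum of x around v|^2 over the vertices v minus 2|x|^2, one obtains
   n^+ <= r + m + w and, there being no augmenting path, n^- >= r + 2w - h, while
   m + h <= 2r by injectivity of the traces. Hence n^+ <= 3n^-, and
   n^+ <= 3n^- - 3 <= n^-(n^- + 1)/2 as soon as n^- > r. *)

(** * Inertia of Hermitian matrices *)

Local Open Scope sesquilinear_scope.

Lemma char_poly_similar n (P D : 'M[algC]_n) :
  P \in unitmx -> char_poly (invmx P *m D *m P) = char_poly D.
Proof.
move=> Pu; rewrite /char_poly.
set Q := map_mx polyC P; set Q' := map_mx polyC (invmx P).
have QQ : Q' *m Q = 1%:M by rewrite -map_mxM mulVmx ?map_mx1.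
have -> : char_poly_mx (invmx P *m D *m P) = Q' *m char_poly_mx D *m Q.
  rewrite /char_poly_mx mulmxBr mulmxBl !map_mxM; congr (_ - _).
  by rewrite scalar_mxC -mulmxA QQ mulmx1.
by rewrite !det_mulmx mulrAC -det_mulmx QQ det1 mul1r.
Qed.

Lemma count_eigenvalues n (P : 'M[algC]_n) (d : 'rV[algC]_n) (p : pred algC) :
  P \in unitmx ->
  count p (eigenvalues (invmx P *m diag_mx d *m P)) = #|[set i | p (d 0 i)]|.
Proof.
move=> Pu; set A := _ *m P.
have pe : perm_eq (eigenvalues A) [seq d 0 i | i <- enum 'I_n].
  apply: prod_XsubC_eq; rewrite -prod_eigenvalues big_map char_poly_similar //.
  rewrite char_poly_trig ?diag_mx_is_trig // [RHS]big_enum /=.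
  by apply: eq_bigr => i _; rewrite mxE eqxx.
move/permP: pe => /(_ p) ->; rewrite count_map cardsE cardE size_filter enumT.
exact: eq_count.
Qed.

Definition hform n (A : 'M[algC]_n) (v : 'rV[algC]_n) : algC :=
  (v *m A *m v^t*) 0 0.

Lemma hform_diag n (P : 'M[algC]_n) (d v : 'rV[algC]_n) : P \is unitarymx ->
  hform (invmx P *m diag_mx d *m P) v
  = \sum_i d 0 i * `|(v *m invmx P) 0 i| ^+ 2.
Proof.
move=> Pu; rewrite /hform.
have -> : v *m (invmx P *m diag_mx d *m P) *m v^t*
          = (v *m invmx P) *m diag_mx d *m (v *m invmx P)^t*.
  by rewrite invmx_unitary // trmx_mul map_mxM trmxCK !mulmxA.
rewrite mxE; apply: eq_bigr => i _.
by rewrite mul_mx_diag !mxE normCK mulrAC mulrC.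
Qed.

Lemma mulmx_row_eq0 m n (B : 'M[algC]_(m, n)) : (n < m)%N ->
  exists2 x : 'rV_m, x != 0 & x *m B = 0.
Proof.
move=> lt_nm; have : kermx B != 0.
  rewrite kermx_eq0 /row_free; apply: contraTneq lt_nm => eqr.
  by rewrite -leqNgt -eqr rank_leq_col.
by case/rowV0Pn => x xK x0; exists x => //; apply/sub_kermxP.
Qed.

Section Inertia.

Variables (n : nat) (A : 'M[algC]_n).
Hypothesis A_herm : A \is hermsymmx.

Let P := spectralmx A.
Let d := spectral_diag A.

Let P_unitary : P \is unitarymx. Proof. exact: spectral_unitarymx. Qed.
Let P_unit : P \in unitmx. Proof. exact: unitarymx_unit. Qed.

Let A_diag : A = invmx P *m diag_mx d *m P.
Proof. exact/orthomx_spectralP/hermitian_normalmx. Qed.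

Let d_real i : d 0 i \is Num.real.
Proof. by move/mxOverP: (hermitian_spectral_diag_real A_herm). Qed.

(** If [r] exceeded the number of negative eigenvalues, some nonzero [x] would give [x *m E] no
    component along negative eigenvectors. The form at [x *m E] would then be nonnegative, hence
    zero, which puts [x *m E] in the kernel of [A]. Isotropic vectors are thus allowed as long as
    they avoid this kernel. *)
Lemma leq_count_neg r (E : 'M[algC]_(r, n)) :
  (forall x : 'rV_r, x != 0 ->
     hform A (x *m E) <= 0 /\ (hform A (x *m E) = 0 -> x *m E *m A != 0)) ->
  (r <= count (fun z : algC => (z < 0)%R) (eigenvalues A))%N.
Proof.
rewrite [X in eigenvalues X]A_diag count_eigenvalues //; set N := [set i | _] => hE.
rewrite leqNgt; apply/negP => ltNr.
have [x x0 xB] := mulmx_row_eq0 (colsub (@enum_val _ (mem N)) (E *m invmx P)) ltNr.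
have uN i : i \in N -> (x *m E *m invmx P) 0 i = 0.
  move=> iN; move/rowP/(_ (enum_rank_in iN i)): xB.
  by rewrite mulmx_colsub mulmxA !mxE enum_rankK_in.
have dpos i : 0 <= d 0 i * `|(x *m E *m invmx P) 0 i| ^+ 2.
  have [iN|iN] := boolP (i \in N); first by rewrite uN // normr0 expr0n mulr0.
  rewrite mulr_ge0 ?exprn_ge0 //; move: iN; rewrite inE.
  by rewrite real_ltNge ?real0 // negbK.
have [le0 nz] := hE x x0.
have q0 : hform A (x *m E) = 0.
  apply: le_anti; rewrite le0 A_diag hform_diag //.
  exact: sumr_ge0.
case/negP: (nz q0); rewrite {1}A_diag !mulmxA.
suff -> : x *m E *m invmx P *m diag_mx d = 0 by rewrite mul0mx.
apply/rowP => i; rewrite mul_mx_diag [LHS]mxE [RHS]mxE.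
move: q0; rewrite A_diag hform_diag // => /eqP.
rewrite psumr_eq0 // => /allP/(_ i); rewrite mem_index_enum => /(_ isT).
by rewrite mulf_eq0 expf_eq0 normr_eq0 /= => /orP[]/eqP ->; rewrite ?mulr0 ?mul0r.
Qed.

(** With more than [c] positive eigenvalues, the span of their eigenvectors would contain a nonzero
    vector killed by [C], where the form is positive. *)
Lemma count_pos_leq c (C : 'M[algC]_(n, c)) :
  (forall v : 'rV_n, v *m C = 0 -> hform A v <= 0) ->
  (count (fun z : algC => (0 < z)%R) (eigenvalues A) <= c)%N.
Proof.
rewrite [X in eigenvalues X]A_diag count_eigenvalues //; set N := [set i | _] => hC.
rewrite leqNgt; apply/negP => ltcN.
pose R := rowsub (@enum_val _ (mem N)) (1%:M : 'M[algC]_n).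
have [x x0 xB] := mulmx_row_eq0 (R *m P *m C) ltcN.
have := hC (x *m R *m P); rewrite -!mulmxA (mulmxA R) xB => /(_ erefl).
apply/negP; rewrite -real_ltNge ?real0 //; last first.
  rewrite A_diag hform_diag // sum_real // => i _.
  by rewrite realM ?realX ?normr_real.
rewrite A_diag hform_diag // mulmxA mulmxK //.
have xR i (iN : i \in N) : (x *m R) 0 i = x 0 (enum_rank_in iN i).
  rewrite mxE (bigD1 (enum_rank_in iN i)) //= big1 => [|j nj].
    by rewrite !mxE enum_rankK_in // eqxx mulr1 addr0.
  rewrite !mxE; case: eqP => [eqi|]; last by rewrite mulr0.
  by case/eqP: nj; apply: enum_val_inj; rewrite enum_rankK_in.
have xR0 i : i \notin N -> (x *m R) 0 i = 0.
  move=> iN; rewrite mxE big1 // => j _; rewrite !mxE.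
  case: eqP => [eqi|]; last by rewrite mulr0.
  by case/negP: iN; rewrite -eqi enum_valP.
have ge0 i : 0 <= d 0 i * `|(x *m R) 0 i| ^+ 2.
  have [iN|iN] := boolP (i \in N); last by rewrite xR0 // normr0 expr0n mulr0.
  by rewrite mulr_ge0 ?exprn_ge0 //; move: iN; rewrite inE => /ltW.
have /rV0Pn [j xj] := x0.
rewrite lt_def sumr_ge0 // andbT psumr_eq0 //; apply/negP => /allP/(_ (enum_val j)).
rewrite mem_index_enum => /(_ isT); apply/negP.
have jN := enum_valP j; rewrite xR enum_valK_in mulf_neq0 //.
  by move: jN; rewrite inE => /gt_eqF ->.
by rewrite expf_neq0 // normr_eq0.
Qed.

End Inertia.

(** * The quadratic form of a graph *)

Section QuadraticForm.

Variable H : sgraph.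
Implicit Types (x y z : H -> algC) (u v e f : H) (S J : {set H}).

Definition nbsum x v : algC := \sum_u (adj v u)%:R * x u.
Definition bform x y : algC := \sum_u x u * (nbsum y u)^*.
Definition qform x : algC := bform x x.

Lemma nbsumE x v : nbsum x v = \sum_(u | adj v u) x u.
Proof.
rewrite [RHS]big_mkcond; apply: eq_bigr => u _.
by case: adj; rewrite ?mul1r ?mul0r.
Qed.

Lemma eq_nbsum x y : x =1 y -> nbsum x =1 nbsum y.
Proof. by move=> xy v; apply: eq_bigr => u _; rewrite xy. Qed.

Lemma eq_bform x x' y y' : x =1 x' -> y =1 y' -> bform x y = bform x' y'.
Proof. by move=> xx yy; apply: eq_bigr => u _; rewrite xx (eq_nbsum yy). Qed.

Lemma bformC x y : bform x y = (bform y x)^*.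
Proof.
rewrite /bform rmorph_sum /=.
under eq_bigr do rewrite /nbsum rmorph_sum mulr_sumr.
under [RHS]eq_bigr do rewrite /nbsum rmorphM /= conjCK mulr_sumr.
rewrite exchange_big /=; apply: eq_bigr => u _; apply: eq_bigr => v _.
by rewrite rmorphM /= conjC_nat mulrCA [RHS]mulrCA adj_sym [x v * _]mulrC.
Qed.

Lemma qform_real x : qform x \is Num.real.
Proof. by apply/CrealP; rewrite /qform -bformC. Qed.

Lemma nbsum_lin (K : finType) (c : K -> algC) (b : K -> H -> algC) v :
  nbsum (fun u => \sum_k c k * b k u) v = \sum_k c k * nbsum (b k) v.
Proof.
rewrite /nbsum; under eq_bigr do rewrite mulr_sumr.
rewrite exchange_big; apply: eq_bigr => k _; rewrite mulr_sumr.
by apply: eq_bigr => u _; rewrite mulrCA.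
Qed.

Lemma bform_sumr (K : finType) (c : K -> algC) (b : K -> H -> algC) x :
  bform x (fun u => \sum_k c k * b k u) = \sum_k (c k)^* * bform x (b k).
Proof.
rewrite /bform; under eq_bigr do rewrite nbsum_lin rmorph_sum mulr_sumr.
rewrite exchange_big; apply: eq_bigr => k _; rewrite mulr_sumr.
by apply: eq_bigr => u _; rewrite rmorphM mulrCA.
Qed.

Lemma bform_suml (K : finType) (c : K -> algC) (b : K -> H -> algC) x :
  bform (fun u => \sum_k c k * b k u) x = \sum_k c k * bform (b k) x.
Proof.
rewrite bformC bform_sumr rmorph_sum; apply: eq_bigr => k _.
by rewrite rmorphM /= conjCK -bformC.
Qed.

Lemma nbsumD x y v : nbsum (fun u => x u + y u) v = nbsum x v + nbsum y v.
Proof. by rewrite -big_split; apply: eq_bigr => u _; rewrite mulrDr. Qed.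

Lemma qformD x y :
  qform (fun u => x u + y u) = qform x + qform y + (bform x y + (bform x y)^*).
Proof.
rewrite -(bformC y x) /qform /bform -!big_split; apply: eq_bigr => u _ /=.
by rewrite nbsumD rmorphD /= mulrDl !mulrDr [X in _ + X]addrC addrACA.
Qed.

Lemma nbsumN x v : nbsum (fun u => - x u) v = - nbsum x v.
Proof. by rewrite -sumrN; apply: eq_bigr => u _; rewrite mulrN. Qed.

Lemma bformNr x y : bform x (fun u => - y u) = - bform x y.
Proof. by rewrite -sumrN; apply: eq_bigr => u _; rewrite nbsumN rmorphN mulrN. Qed.

Lemma qformN x : qform (fun u => - x u) = qform x.
Proof.
by apply: eq_bigr => u _; rewrite nbsumN rmorphN mulrNN.
Qed.

Lemma adjmx_herm : adjmx H \is hermsymmx.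
Proof.
apply/is_hermitianmxP; rewrite expr0 scale1r; apply/matrixP => i j.
by rewrite !mxE conjC_nat adj_sym.
Qed.

Definition rowfun x : 'rV[algC]_#|H| := \row_i x (enum_val i).
Definition funrow (a : 'rV[algC]_#|H|) v : algC := a 0 (enum_rank v).

Lemma funrowK a : rowfun (funrow a) = a.
Proof. by apply/rowP => i; rewrite mxE /funrow enum_valK. Qed.

Lemma sum_enum_val (F : H -> algC) :
  \sum_v F v = \sum_(i < #|H|) F (enum_val i).
Proof. by rewrite (reindex _ (onW_bij _ (enum_val_bij H))). Qed.

Lemma mul_rowfun_adjmx x : rowfun x *m adjmx H = rowfun (nbsum x).
Proof.
apply/rowP => j; rewrite !mxE /nbsum sum_enum_val; apply: eq_bigr => i _.
by rewrite !mxE mulrC adj_sym.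
Qed.

Lemma hform_rowfun x : hform (adjmx H) (rowfun x) = qform x.
Proof.
rewrite /hform mul_rowfun_adjmx /qform bformC rmorph_sum sum_enum_val mxE.
by apply: eq_bigr => i _; rewrite !mxE rmorphM /= conjCK mulrC.
Qed.

Lemma leq_nneg_span (K : finType) (b : K -> H -> algC) :
  (forall c : K -> algC, (exists k, c k != 0) ->
     let x v := \sum_k c k * b k v in
     qform x <= 0 /\ (qform x = 0 -> exists v, nbsum x v != 0)) ->
  (#|K| <= nneg H)%N.
Proof.
move=> hb; pose E : 'M_(#|K|, #|H|) := \matrix_(i, j) b (enum_val i) (enum_val j).
apply: (leq_count_neg adjmx_herm (E := E)) => a /rV0Pn [i ai].
pose c k := a 0 (enum_rank k).
have [|/= q0 qn] := hb c; first by exists (enum_val i); rewrite /c enum_valK.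
have -> : a *m E = rowfun (fun v => \sum_k c k * b k v).
  apply/rowP => j; rewrite !mxE (reindex _ (onW_bij _ (enum_val_bij K))) /=.
  by apply: eq_bigr => l _; rewrite mxE /c enum_valK.
rewrite hform_rowfun mul_rowfun_adjmx; split=> // /qn [v nv].
by apply/rV0Pn; exists (enum_rank v); rewrite mxE enum_rankK.
Qed.

(** The common kernel of the [#|K|] linear forms [b k] has dimension at least [#|H| - #|K|];
    [leq_count_neg] is applied to a basis of it. *)
Lemma leq_nneg_ker (K : finType) (b : K -> H -> algC) :
  (forall x, (exists v, x v != 0) -> (forall k, \sum_v b k v * x v = 0) ->
     qform x <= 0 /\ (qform x = 0 -> exists v, nbsum x v != 0)) ->
  (#|H| <= nneg H + #|K|)%N.
Proof.
move=> hb; pose C : 'M_(#|H|, #|K|) := \matrix_(i, j) b (enum_val j) (enum_val i).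
have : (\rank (kermx C) <= nneg H)%N.
  apply: (leq_count_neg adjmx_herm (E := row_base (kermx C))) => a a0.
  set r := a *m _; have r0 : r != 0.
    rewrite -(mul0mx 1 (row_base (kermx C))) /r.
    by apply: contraNneq a0 => /(row_free_inj (row_base_free _)) ->.
  have rC : r *m C = 0.
    by apply/sub_kermxP; rewrite (submx_trans (submxMl _ _)) // eq_row_base.
  move: r r0 rC => r r0 rC {a a0}; have [||q0 qn] := hb (funrow r).
  - by have /rV0Pn [i ri] := r0; exists (enum_val i); rewrite /funrow enum_valK.
  - move=> k; move/rowP/(_ (enum_rank k)): rC; rewrite !mxE => rCk; rewrite -[RHS]rCk.
    rewrite sum_enum_val; apply: eq_bigr => i _.
    by rewrite !mxE /funrow enum_valK enum_rankK mulrC.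
  rewrite -[r]funrowK hform_rowfun mul_rowfun_adjmx; split=> // /qn [v nv].
  by apply/rV0Pn; exists (enum_rank v); rewrite mxE enum_rankK.
rewrite mxrank_ker leq_subLR addnC => /leq_trans -> //.
by rewrite leq_add2l rank_leq_col.
Qed.

Lemma npos_leq (K : finType) (b : K -> H -> algC) :
  (forall x, (forall k, \sum_v b k v * x v = 0) -> qform x <= 0) ->
  (npos H <= #|K|)%N.
Proof.
move=> hb; pose C : 'M_(#|H|, #|K|) := \matrix_(i, j) b (enum_val j) (enum_val i).
apply: (count_pos_leq adjmx_herm (C := C)) => r rC.
rewrite -[r]funrowK hform_rowfun; apply: hb => k.
move/rowP/(_ (enum_rank k)): rC; rewrite !mxE => rCk; rewrite -[RHS]rCk.
rewrite sum_enum_val; apply: eq_bigr => i _.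
by rewrite !mxE /funrow enum_valK enum_rankK mulrC.
Qed.

End QuadraticForm.

(** * Stable sets *)

Definition stable (H : sgraph) (S : {set H}) :=
  forall e f : H, e \in S -> f \in S -> adj e f = false.

Definition off (H : sgraph) (S : {set H}) (x : H -> algC) v :=
  if v \in S then 0 else x v.

Definition rows_free (H : sgraph) (J : {set H}) :=
  forall x : H -> algC,
  (forall f, \sum_(e in J) x e * (adj e f)%:R = 0) -> {in J, forall e, x e = 0}.

Definition rows_span (H : sgraph) (S J : {set H}) :=
  {in S, forall e, exists l : H -> algC,
    forall f, (adj e f)%:R = \sum_(j in J) l j * (adj j f)%:R}.

Lemma rows_basis_exists (H : sgraph) (S : {set H}) :
  exists J : {set H}, [/\ J \subset S, rows_free J & rows_span S J].
Proof.
pose T : 'M[algC]_(#|S|, #|H|) :=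
  \matrix_(i, j) (adj (enum_val i) (enum_val j))%:R.
pose g := maxrankfun T; pose J := [set enum_val (g k) | k : 'I_(\rank T)].
have gJ : injective (fun k => enum_val (g k)).
  by move=> k l /enum_val_inj /maxrankfun_inj.
have sumJ (F : H -> algC) : \sum_(e in J) F e = \sum_k F (enum_val (g k)).
  by rewrite big_imset //= => k l _ _; apply: gJ.
exists J; split.
- by apply/subsetP => _ /imsetP [k _ ->]; apply: enum_valP.
- move=> x x0 _ /imsetP [k _ ->].
  have /(row_free_inj (maxrowsub_free T)) :
    (\row_k x (enum_val (g k))) *m rowsub g T = 0 *m rowsub g T.
    rewrite mul0mx; apply/rowP => j; rewrite [RHS]mxE -[RHS](x0 (enum_val j)).
    by rewrite sumJ mxE; apply: eq_bigr => i _; rewrite !mxE.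
  by move/rowP/(_ k); rewrite !mxE.
- move=> e eS; have : (row (enum_rank_in eS e) T <= rowsub g T)%MS.
    by rewrite eq_maxrowsub row_sub.
  case/submxP => D /rowP TD.
  (* This extends the coefficients [D] by zero outside [J]; by [gJ] the sum has at most one term. *)
  pose l f := \sum_(k | enum_val (g k) == f) D 0 k.
  exists l => f; have := TD (enum_rank f).
  rewrite !mxE enum_rankK enum_rankK_in // => ->.
  rewrite sumJ; apply: eq_bigr => k _; rewrite !mxE enum_rankK /l.
  by rewrite (big_pred1 k) // => j; rewrite /= (inj_eq gJ).
Qed.

Section StableSet.

Variables (H : sgraph) (S : {set H}).
Hypothesis S_stable : stable S.

(** Split [x] into its part on [S] and [off S x]: the former is isotropic by stability, and the
    hypothesis kills the cross term. *)
Lemma qform_off (x : H -> algC) :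
  {in S, forall e, x e != 0 -> nbsum (off S x) e = 0} ->
  qform x = qform (off S x).
Proof.
move=> hx; pose y v := if v \in S then x v else 0.
have -> : qform x = qform (fun v => y v + off S x v).
  by apply: eq_bform => v; rewrite /y /off; case: ifP; rewrite ?add0r ?addr0.
have y0 : bform y y = 0.
  apply: big1 => u _; rewrite {1}/y; case: ifP => uS; last by rewrite mul0r.
  rewrite nbsumE big1 ?rmorph0 ?mulr0 // => v auv; rewrite /y ifN //.
  by apply: contraTN auv => vS; rewrite S_stable.
have yx0 : bform y (off S x) = 0.
  apply: big1 => u _; rewrite /y; case: ifP => uS; last by rewrite mul0r.
  have [->|xu] := eqVneq (x u) 0; first by rewrite mul0r.
  by rewrite hx // rmorph0 mulr0.
by rewrite qformD {1}/qform y0 yx0 rmorph0 addr0 add0r addr0.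
Qed.

Variable J : {set H}.
Hypothesis J_sub : J \subset S.
Hypothesis J_free : rows_free J.
Hypothesis J_span : rows_span S J.

Lemma nbsum_span y : {in J, forall e, nbsum y e = 0} ->
  {in S, forall e, nbsum y e = 0}.
Proof.
move=> y0 e eS; have [l le] := J_span eS.
rewrite /nbsum; under eq_bigr do rewrite le mulr_suml.
rewrite exchange_big big1 // => j jJ /=.
under eq_bigr do rewrite -mulrA.
by rewrite -mulr_sumr -/(nbsum y j) y0 ?mulr0.
Qed.

(** By symmetry of the adjacency matrix, [nbsum x] is the combination of the independent rows [J]
    with coefficients [x]. *)
Lemma nbsum_free x : (forall v, v \notin J -> x v = 0) ->
  (exists v, x v != 0) -> exists v, nbsum x v != 0.
Proof.
move=> xJ [v xv]; apply/existsP; apply: contraNT xv.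
rewrite negb_exists => /forallP nx; apply/eqP.
have [vJ|] := boolP (v \in J); last exact: xJ.
apply: (J_free (x := x)) => // f; have := nx f; rewrite negbK => /eqP nf; rewrite -[RHS]nf.
rewrite /nbsum [RHS](bigID (mem J)) /= [X in _ + X]big1 ?addr0.
  by apply: eq_bigr => e _; rewrite mulrC adj_sym.
by move=> e /xJ ->; rewrite mulr0.
Qed.

(** The vectors supported on [J] form an isotropic space of dimension [#|J|] on which the adjacency
    matrix is injective. It is presented as the kernel of the coordinates outside [J]. *)
Lemma card_basis_nneg : (#|J| <= nneg H)%N.
Proof.
pose b (k : {f | f \notin J}) f : algC := (f == val k)%:R.
suff : (#|H| <= nneg H + #|{: {f | f \notin J}}|)%N.
  rewrite card_sig -(cardC (mem J)) (_ : #|[pred f | _]| = #|[predC J]|).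
    by rewrite leq_add2r.
  exact: eq_card.
apply: (leq_nneg_ker (b := b)) => x x0 xb.
have xJ f : f \notin J -> x f = 0.
  move=> fJ; rewrite -[RHS](xb (exist _ f fJ)) (bigD1 f) //= /b eqxx mul1r.
  by rewrite big1 ?addr0 // => g /negbTE gf; rewrite gf mul0r.
have off0 f : off S x f = 0.
  rewrite /off; case: ifPn => // fS; apply: xJ.
  by apply: contraNN fS; apply: (subsetP J_sub).
rewrite qform_off => [|e _ _]; last by apply: big1 => u _; rewrite off0 mulr0.
rewrite [qform _]big1 => [|u _]; last by rewrite off0 mul0r.
by split=> // _; apply: nbsum_free.
Qed.

Definition trace f := [set j in J | adj j f].
Definition nbset f := [set e in S | adj e f].

(** The rows [S] are combinations of the rows [J], so the entries of a column in [J] determine its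
    entries in [S]. *)
Lemma trace_inj f f' : trace f = trace f' ->
  {in S, forall e, adj e f = adj e f'}.
Proof.
move=> /setP eqt e eS; have [l le] := J_span eS.
have /eqP : (adj e f)%:R = (adj e f')%:R :> algC.
  rewrite !le; apply: eq_bigr => j jJ; have := eqt j.
  by rewrite !inE jJ /= => ->.
by rewrite eqr_nat; do 2!case: adj.
Qed.

Lemma trace_neq0 e f : e \in S -> adj e f -> trace f != set0.
Proof.
move=> eS aef; apply/negP => /eqP /setP t0; have [l le] := J_span eS.
have /eqP : (adj e f)%:R = 0 :> algC.
  rewrite le big1 // => j jJ; have := t0 j; rewrite !inE jJ /= => ->.
  by rewrite mulr0.
by rewrite aef oner_eq0.
Qed.

Lemma trace_nbset f : trace f = nbset f :&: J.
Proof.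
apply/setP => e; rewrite !inE; have [eJ|] := boolP (e \in J); last by rewrite andbF.
by rewrite (subsetP J_sub) ?andbT.
Qed.

(* A vector [y] with [qform y < 0] could be added to the isotropic space spanned
   by [J] to bound [nneg H] below by [#|J| + 1]. *)
Lemma qform_ge0 y : (nneg H <= #|J|)%N -> {in S, forall e, y e = 0} ->
  {in J, forall e, nbsum y e = 0} -> 0 <= qform y.
Proof.
move=> leJ yS yJ; rewrite real_leNgt ?real0 ?qform_real //; apply/negP => qy.
pose b (k : {j | j \in J} + unit) v : algC :=
  if k is inl j then (v == val j)%:R else y v.
suff : (#|{: {j | j \in J} + unit}| <= nneg H)%N.
  by rewrite card_sum card_sig card_unit addn1 leqNgt ltnS leJ.
apply: (leq_nneg_span (b := b)) => c [k ck] x.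
pose a v := \sum_(j : {j | j \in J}) c (inl j) * (v == val j)%:R.
have xE v : x v = a v + c (inr tt) * y v.
  by rewrite /x big_sumType /= [X in _ + X](big_pred1 tt) //; case.
have aJ v : v \notin J -> a v = 0.
  move=> vJ; apply: big1 => j _; case: eqP => [vj|]; last by rewrite mulr0.
  by case/negP: vJ; rewrite vj (valP j).
have aval j : a (val j) = c (inl j).
  rewrite /a (bigD1 j) //= eqxx mulr1 big1 ?addr0 // => i ij.
  by rewrite (inj_eq val_inj) eq_sym (negbTE ij) mulr0.
have offx v : off S x v = c (inr tt) * y v.
  rewrite /off; case: ifPn => [vS|vS]; first by rewrite yS ?mulr0.
  by rewrite xE aJ ?add0r //; apply: contraNN vS; apply: (subsetP J_sub).
have nbx e : e \in S -> nbsum (off S x) e = 0.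
  move=> eS; rewrite (eq_nbsum offx) /nbsum.
  under eq_bigr do rewrite mulrCA.
  by rewrite -mulr_sumr -/(nbsum y e) (nbsum_span yJ) ?mulr0.
have qx : qform x = `|c (inr tt)| ^+ 2 * qform y.
  rewrite qform_off; last by move=> e eS _; apply: nbx.
  rewrite /qform (eq_bform offx offx) normCK /bform mulr_sumr; apply: eq_bigr => u _.
  rewrite /nbsum; under eq_bigr do rewrite mulrCA.
  by rewrite -mulr_sumr rmorphM mulrACA.
rewrite qx; split; first by rewrite mulr_ge0_le0 ?exprn_ge0 // ltW.
(* If the form vanishes at [x], so does the coefficient of [y], and [x] is supported on [J]. *)
move/eqP; rewrite mulf_eq0 (lt_eqF qy) orbF expf_eq0 normr_eq0 /= => /eqP c0.
have xa v : x v = a v by rewrite xE c0 mul0r addr0.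
apply: nbsum_free => [v vJ|]; first by rewrite xa aJ.
case: k ck => [j|[]]; last by rewrite c0 eqxx.
by exists (val j); rewrite xa aval.
Qed.

(** * Classes of vertices outside [S] with equal traces *)

Hypothesis S_max : forall f, f \notin S -> nbset f != set0.
Hypothesis S_small : forall f, (#|nbset f| <= 2)%N.

(** A canonical member of the class of [f]. For [f] outside [S], [f] itself is a candidate, so the
    default is reached only for [f] in [S]. *)
Definition repr f : H := odflt f [pick g | (g \notin S) && (trace g == trace f)].

Lemma repr_notin f : f \notin S -> repr f \notin S.
Proof. by move=> fS; rewrite /repr; case: pickP => //= g /andP []. Qed.

Lemma trace_repr f : trace (repr f) = trace f.
Proof. by rewrite /repr; case: pickP => //= g /andP [_ /eqP]. Qed.

Lemma repr_trace f g : f \notin S -> trace f = trace g -> repr f = repr g.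
Proof.
move=> fS eqt; rewrite /repr eqt; case: pickP => //= /(_ f).
by rewrite fS eqt eqxx.
Qed.

Definition diffrepr f (v : H) : algC := (v == f)%:R - (v == repr f)%:R.

Lemma sum_delta (F : H -> algC) f : \sum_v F v * (v == f)%:R = F f.
Proof.
rewrite (bigD1 f) //= eqxx mulr1 big1 ?addr0 // => v /negbTE ->.
by rewrite mulr0.
Qed.

Lemma nbsum_diffrepr f e :
  nbsum (diffrepr f) e = (adj e f)%:R - (adj e (repr f))%:R.
Proof.
rewrite /nbsum /diffrepr; under eq_bigr do rewrite mulrBr.
by rewrite sumrB !sum_delta.
Qed.

Lemma nbsum_diffrepr0 f e : e \in S -> nbsum (diffrepr f) e = 0.
Proof.
by move=> eS; rewrite nbsum_diffrepr (trace_inj (trace_repr f)) // subrr.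
Qed.

Lemma diffrepr_off f e : f \notin S -> e \in S -> diffrepr f e = 0.
Proof.
move=> fS eS; have rS := repr_notin fS; rewrite /diffrepr.
case: eqP => [ef|_]; first by rewrite -ef eS in fS.
by case: eqP => [ef|_]; [rewrite -ef eS in rS | rewrite subrr].
Qed.

Lemma bform_diffrepr f g :
  bform (diffrepr f) (diffrepr g) =
  (adj f g)%:R - (adj f (repr g))%:R
  - ((adj (repr f) g)%:R - (adj (repr f) (repr g))%:R).
Proof.
rewrite /bform; under eq_bigr do rewrite mulrC mulrBr.
by rewrite sumrB !sum_delta !nbsum_diffrepr !rmorphB /= !conjC_nat.
Qed.

(* [f] and [repr f] have the same neighbours in [S], and
   [qform (diffrepr f) = - 2 * adj f (repr f) <= 0]: the positive semidefinite
   form of [qform_ge0] vanishes on the vectors [diffrepr f], hence so do the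
   cross terms. *)
Lemma bform_diffrepr_eq0 f g : (nneg H <= #|J|)%N -> f \notin S -> g \notin S ->
  bform (diffrepr f) (diffrepr g) = 0.
Proof.
move=> leJ fS gS.
have ge0 y : {in S, forall e, y e = 0} -> {in S, forall e, nbsum y e = 0} ->
    0 <= qform y.
  by move=> yS yJ; apply: qform_ge0 => // e /(subsetP J_sub); apply: yJ.
have q0 h : h \notin S -> qform (diffrepr h) = 0.
  move=> hS; apply: le_anti; rewrite ge0; first 1 last.
  - by move=> e eS; apply: diffrepr_off.
  - by move=> e eS; apply: nbsum_diffrepr0.
  rewrite andbT /qform bform_diffrepr !adj_irrefl sub0r subr0 adj_sym -opprD.
  by rewrite oppr_le0 -natrD ler0n.
set B := bform _ _; have BR : B^* = B.
  by rewrite /B bform_diffrepr !rmorphB /= !conjC_nat.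
have : 0 <= qform (fun u => diffrepr f u + diffrepr g u).
  apply: ge0 => e eS; first by rewrite !diffrepr_off ?addr0.
  by rewrite nbsumD !nbsum_diffrepr0 ?addr0.
rewrite qformD !q0 // addr0 add0r -/B BR -mulr2n pmulrn_lge0 // => B0.
have : 0 <= qform (fun u => diffrepr f u + - diffrepr g u).
  apply: ge0 => e eS; first by rewrite !diffrepr_off ?subr0.
  by rewrite nbsumD nbsumN !nbsum_diffrepr0 ?subr0.
rewrite qformD qformN !q0 // addr0 add0r bformNr -/B rmorphN /= BR.
rewrite -mulr2n pmulrn_lge0 // oppr_ge0 => B1.
by apply: le_anti; rewrite B1.
Qed.

Definition traces := [set T : {set H} | (T \subset J) && (0 < #|T| <= 2)%N].

(** Singletons and pairs number [r + r(r-1)/2] with [r = #|J|]; doubling avoids the division. *)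
Lemma card_traces : (#|traces| * 2 = #|J| * #|J|.+1)%N.
Proof.
have -> : traces = [set T : {set H} | (T \subset J) & (#|T| == 1%N)]
               :|: [set T : {set H} | (T \subset J) & (#|T| == 2%N)].
  by apply/setP => T; rewrite !inE -andb_orr; case: #|T| => [|[|[|]]].
rewrite cardsU disjoint_setI0 ?cards0 ?subn0; last first.
  rewrite -setI_eq0; apply/eqP/setP => T; rewrite !inE.
  by case: (T \subset J); case: #|T| => [|[|[|]]].
rewrite !cards_draws bin1 mulnDl -[2%N in X in (_ + X)%N]/(2`!) bin_ffact.
by rewrite ffactnS ffactn1 -mulnDr; case: #|J|.
Qed.

Lemma trace_in f : f \notin S -> trace f \in traces.
Proof.
move=> fS; rewrite inE; apply/and3P; split.
- by apply/subsetP => e; rewrite inE => /andP [].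
- have /set0Pn [e] := S_max fS; rewrite inE => /andP [eS aef].
  by rewrite card_gt0 (trace_neq0 eS).
- by rewrite trace_nbset (leq_trans (subset_leq_card (subsetIl _ _))).
Qed.

(** One linear condition per trace: the entries of [x] over each class outside [S] sum to zero. Then
    [off S x] is a combination of vectors [diffrepr f], on whose span the form vanishes. *)
Lemma npos_traces : (nneg H <= #|J|)%N -> (npos H * 2 <= #|J| * #|J|.+1)%N.
Proof.
move=> leJ; rewrite -card_traces leq_mul2r /=.
rewrite -[#|traces|]card_sig.
pose b (T : {T | T \in traces}) f : algC := ((f \notin S) && (trace f == val T))%:R.
apply: (npos_leq (b := b)) => x xb.
have sumT (F : H -> algC) :
    (forall f g, f \notin S -> g \notin S -> trace f = trace g -> F f = F g) ->
    \sum_(f | f \notin S) F f * x f = 0.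
  move=> hF; rewrite (partition_big trace (mem traces)) /=; last exact: trace_in.
  apply: big1 => T Tt.
  have [g /andP [gS /eqP gT]|none] := pickP (fun g => (g \notin S) && (trace g == T)).
    have := xb (exist _ T Tt); rewrite /b /= => xT.
    rewrite (eq_bigr (fun f => F g * x f)); last first.
      by move=> f /andP [fS /eqP fT]; rewrite (hF f g) ?fT ?gT.
    rewrite -mulr_sumr big_mkcond /= -[RHS](mulr0 (F g)) -[in RHS]xT; congr (_ * _).
    by apply: eq_bigr => f _; case: ifP => _; rewrite ?mul1r ?mul0r.
  by rewrite big_pred0.
(* The terms at [repr f] cancel: by [sumT], the entries of [x] off [S] sharing a representative sum
   to zero. *)
have offE v : off S x v = \sum_f (off S x f) * diffrepr f v.
  rewrite /diffrepr; under eq_bigr do rewrite mulrBr eq_sym.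
  rewrite sumrB sum_delta [X in _ - X](_ : _ = 0) ?subr0 //.
  rewrite (bigID (mem S)) /= big1 ?add0r => [|f fS]; last by rewrite /off fS mul0r.
  rewrite -[RHS](sumT (fun f => (v == repr f)%:R)).
    by apply: eq_bigr => f fS; rewrite /off (negbTE fS) mulrC.
  by move=> f g fS gS /(repr_trace fS) ->.
rewrite qform_off; last first.
  move=> e eS _; rewrite /nbsum (bigID (mem S)) /= big1 ?add0r; last first.
    by move=> f fS; rewrite /off fS mulr0.
  rewrite -[RHS](sumT (fun f => (adj e f)%:R)).
    by apply: eq_bigr => f fS; rewrite /off (negbTE fS).
  by move=> f g _ _ /trace_inj ->.
rewrite /qform (eq_bform offE offE) bform_suml big1 // => f _.
rewrite bform_sumr; have [fS|fS] := boolP (f \in S).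
  by rewrite {1}/off fS mul0r.
rewrite big1 ?mulr0 // => g _; have [gS|gS] := boolP (g \in S).
  by rewrite /off gS rmorph0 mul0r.
by rewrite bform_diffrepr_eq0 // mulr0.
Qed.

(** * Counting the touched and pendant members of [S] by traces *)

Definition touched := [set e in S | [exists f, adj e f]].
Definition pendant := [set e in S | [exists f, nbset f == [set e]]].

(* A touched [e] outside [J] has a neighbour whose trace is a single
   [g e \in J]; by [trace_inj], [g] is injective and avoids [pendant]. *)
Lemma card_touched_pendant : (#|touched| + #|pendant| <= 2 * #|J|)%N.
Proof.
have pJ : pendant \subset J.
  apply/subsetP => e; rewrite inE => /andP [eS /existsP [f /eqP nf]].
  have aef : adj e f by move/setP/(_ e): nf; rewrite !inE eqxx eS.
  have /set0Pn [j] := trace_neq0 eS aef; rewrite trace_nbset nf !inE.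
  by case/andP => /eqP ->.
pose nb e : H := odflt e [pick f | adj e f].
have nbP e : e \in touched -> adj e (nb e).
  by rewrite inE /nb => /andP [_ /existsP [f aef]]; case: pickP => //= /(_ f); rewrite aef.
pose g e : H := odflt e [pick j in trace (nb e)].
have gP e : e \in touched -> g e \in trace (nb e).
  move=> et; have eS : e \in S by move: et; rewrite inE => /andP [].
  have /set0Pn [j jt] := trace_neq0 eS (nbP e et).
  by rewrite /g; case: pickP => //= /(_ j); rewrite jt.
(* Since [e] is outside [J] and [g e] inside, these two distinct members exhaust a neighbour set of
   size at most 2. *)
have nbE e : e \in touched :\: J -> nbset (nb e) = [set e; g e].
  case/setDP => et eJ; have eS : e \in S by move: et; rewrite inE => /andP [].
  have := gP e et; rewrite trace_nbset => /setIP [gn gJ].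
  apply/esym/eqP; rewrite eqEcard subUset !sub1set gn inE eS nbP //= cards2.
  by rewrite (leq_trans (S_small _)) //; case: eqP => // eg; rewrite eg gJ in eJ.
have gJ e : e \in touched -> g e \in J.
  by move/gP; rewrite trace_nbset => /setIP [].
have trE e : e \in touched :\: J -> trace (nb e) = [set g e].
  move=> eD; rewrite trace_nbset nbE //; case/setDP: eD => et eJ.
  apply/setP => j; rewrite !inE; have [->|_] /= := eqVneq j e.
    by rewrite (negbTE eJ); apply/esym/negP => /eqP eg; rewrite eg gJ in eJ.
  by case: eqP => // ->; rewrite gJ.
have nbset_tr f f' : trace f = trace f' -> nbset f = nbset f'.
  move=> /trace_inj tt; apply/setP => e; rewrite !inE.
  by case: (boolP (e \in S)) => //= /tt ->.
(* Equal values of [g] give equal traces, hence equal pairs [{e, g e}], whose only member outside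
   [J] is [e]. *)
have ginj : {in touched :\: J &, injective g}.
  move=> e e' eD eD' eg; have := nbE _ eD; have := nbE _ eD'.
  rewrite (nbset_tr (nb e') (nb e)) ?trE ?eg // => -> /setP/(_ e').
  rewrite !inE eqxx /= -eg; case: eqP => [-> //|_ /=] /esym/eqP ge.
  by case/setDP: eD' => _; rewrite ge gJ //; case/setDP: eD.
(* If [g e] were pendant through [f], then [f] and [nb e] would have the same trace [{g e}],
   although only [nb e] is adjacent to [e]. *)
have disj : [disjoint g @: (touched :\: J) & pendant].
  rewrite -setI_eq0; apply: contraT => /set0Pn [_ /setIP [/imsetP [e eD ->]]].
  rewrite inE => /andP [_ /existsP [f /eqP nf]].
  have : trace f = trace (nb e).
    rewrite trE // trace_nbset nf; apply/setP => j; rewrite !inE.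
    by case: eqP => // ->; rewrite gJ //; case/setDP: eD.
  move/nbset_tr; rewrite nf nbE // => /setP/(_ e); rewrite !inE eqxx /=.
  by move/eqP => eg; case/setDP: eD => et; rewrite eg gJ.
have : (#|touched :\: J| + #|pendant| <= #|J|)%N.
  rewrite -(card_in_imset ginj) -cardsUI disjoint_setI0 // cards0 addn0.
  rewrite subset_leq_card // subUset pJ andbT; apply/subsetP => _ /imsetP [e eD ->].
  by rewrite gJ //; case/setDP: eD.
rewrite mul2n -addnn; move=> le1.
rewrite -(cardsID J touched) -addnA leq_add //.
by rewrite subset_leq_card // subsetIr.
Qed.

End StableSet.

(** * Line graphs *)

Section LineGraph.

Variable G : sgraph.
Local Notation L := (line_graph G).
Implicit Types (e f g : L) (u v w : G) (x y : L -> algC).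

Definition ends (f : L) : {set G} := val f.

Lemma card_ends f : #|ends f| = 2%N.
Proof.
have := valP f; rewrite inE => /existsP [u /existsP [v /andP [auv /eqP fE]]].
rewrite /ends fE cards2; case: eqP => // uv.
by rewrite uv adj_irrefl in auv.
Qed.

Lemma ends_inj : injective ends. Proof. exact: val_inj. Qed.

Lemma line_adjE f g : adj f g = (f != g) && (ends f :&: ends g != set0).
Proof. by []. Qed.

Lemma ends_eq f u v : u \in ends f -> v \in ends f -> u != v ->
  ends f = [set u; v].
Proof.
move=> uf vf uv; apply/esym/eqP.
by rewrite eqEcard subUset !sub1set uf vf cards2 uv card_ends.
Qed.

(** This is the identity [N^T N = A + 2 I] for the vertex-edge incidence matrix [N] of [G]: two
    distinct edges share at most one endpoint. *)
Lemma card_endsI f g : #|ends f :&: ends g| = (adj f g + 2 * (f == g))%N.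
Proof.
rewrite line_adjE; case: eqVneq => [->|fg] /=; first by rewrite setIid card_ends.
have : (#|ends f :&: ends g| <= 1)%N.
  rewrite leqNgt; apply: contra fg => /card_gt1P [u [v [/setIP [uf ug] /setIP [vf vg] uv]]].
  by apply/eqP/ends_inj; rewrite (ends_eq uf vf uv) (ends_eq ug vg uv).
by rewrite addn0 -card_gt0; case: #|_| => [|[]].
Qed.

Definition star x v : algC := \sum_(f : L | v \in ends f) x f.

Lemma sum_star x f : \sum_(v in ends f) star x v = nbsum x f + 2%:R * x f.
Proof.
rewrite /star (exchange_big_dep predT) //=.
rewrite (eq_bigr (fun g => (adj f g)%:R * x g + 2%:R * (x g * (g == f)%:R))).
  by rewrite big_split -mulr_sumr (sum_delta x f).
move=> g _; rewrite (eq_bigl (mem (ends f :&: ends g))); last first.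
  by move=> v; rewrite !inE.
rewrite sumr_const card_endsI mulrnDr mulr_natl mulrCA -natrM mulr_natr.
by rewrite [g == f]eq_sym.
Qed.

(** Here [star x] is [N x] for the incidence matrix [N], and [A = N^T N - 2 I]. *)
Lemma qform_star x :
  qform x = \sum_v `|star x v| ^+ 2 - 2%:R * \sum_f `|x f| ^+ 2.
Proof.
have -> : \sum_v `|star x v| ^+ 2 = \sum_f x f * (nbsum x f + 2%:R * x f)^*.
  under eq_bigr do rewrite normCK {1}/star mulr_suml.
  rewrite (exchange_big_dep predT) //=; apply: eq_bigr => f _.
  by rewrite -mulr_sumr -sum_star rmorph_sum.
rewrite mulr_sumr -sumrB; apply: eq_bigr => f _.
by rewrite rmorphD rmorphM /= conjC_nat mulrDr mulrCA normCK addrK.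
Qed.

Lemma sum_sum_ends (P : pred G) (F : L -> algC) :
  \sum_(v | P v) \sum_(f : L | v \in ends f) F f
  = \sum_f F f *+ #|[set v in ends f | P v]|.
Proof.
rewrite (exchange_big_dep predT) //=; apply: eq_bigr => f _.
rewrite -sumr_const; apply: eq_bigl => v.
by rewrite inE andbC.
Qed.

(** For two terms, the parallelogram law gives the difference of the two sides as
    [|F s - F t|^2]. *)
Lemma norm_sum_card_le2 (T : finType) (A : {set T}) (F : T -> algC) :
  (#|A| <= 2)%N -> `|\sum_(t in A) F t| ^+ 2 <= 2%:R * \sum_(t in A) `|F t| ^+ 2.
Proof.
rewrite leq_eqVlt => /orP [/cards2P [s [t [st ->]]]|].
  rewrite !big_setU1 ?inE //= !big_set1 -subr_ge0.
  suff -> : 2%:R * (`|F s| ^+ 2 + `|F t| ^+ 2) - `|F s + F t| ^+ 2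
            = `|F s - F t| ^+ 2 by rewrite exprn_ge0.
  by rewrite !normCK rmorphD rmorphB /=; ring.
rewrite ltnS => A1; have -> : `|\sum_(t in A) F t| ^+ 2 = \sum_(t in A) `|F t| ^+ 2.
  have [->|[t At]] := set_0Vmem A; first by rewrite !big_set0 normr0 expr0n.
  have -> : A = [set t].
    by apply/esym/eqP; rewrite eqEcard sub1set At cards1.
  by rewrite !big_set1.
by rewrite mulr_natl mulr2n lerDl sumr_ge0 // => t _; rewrite exprn_ge0.
Qed.

Variable S : {set L}.
Hypothesis S_stable : stable S.
Hypothesis S_max : forall S' : {set L}, stable S' -> (#|S'| <= #|S|)%N.

Definition matched := \bigcup_(e in S) ends e.

Lemma matchedP v : reflect (exists2 e, e \in S & v \in ends e) (v \in matched).
Proof. exact: bigcupP. Qed.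

Lemma ends_adj e f v : v \in ends e -> v \in ends f -> e != f -> adj e f.
Proof.
by move=> ve vf ef; rewrite line_adjE ef; apply/set0Pn; exists v; rewrite inE ve.
Qed.

Lemma matching_inj e e' v : e \in S -> e' \in S ->
  v \in ends e -> v \in ends e' -> e = e'.
Proof.
move=> eS eS' ve ve'; apply: contraTeq isT => /(ends_adj ve ve').
by rewrite S_stable.
Qed.

Lemma nbset_max f : f \notin S -> nbset S f != set0.
Proof.
move=> fS; apply/negP => /eqP /setP n0.
have nadj e : e \in S -> adj e f = false.
  by move=> eS; have := n0 e; rewrite !inE eS.
suff /S_max : stable (f |: S) by rewrite cardsU1 fS ltnn.
move=> e e' /setU1P [->|eS] /setU1P [->|eS'].
- exact: adj_irrefl.
- by rewrite adj_sym nadj.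
- exact: nadj.
- exact: S_stable.
Qed.

Lemma unmatched_notin f v : v \in ends f -> v \notin matched -> f \notin S.
Proof. by move=> vf; apply: contraNN => fS; apply/matchedP; exists f. Qed.

(** Distinct edges of a matching meet [f] at distinct vertices, so sending each matched end of [f]
    to its matching edge covers [nbset S f]. *)
Lemma card_nbset_matched f : f \notin S ->
  (#|nbset S f| <= #|ends f :&: matched|)%N.
Proof.
move=> fS; pose m v : L := odflt f [pick e in S | v \in ends e].
suff sub : nbset S f \subset m @: (ends f :&: matched).
  exact: leq_trans (subset_leq_card sub) (leq_imset_card _ _).
apply/subsetP => e; rewrite inE line_adjE => /and3P [eS _ /set0Pn [v /setIP [ve vf]]].
apply/imsetP; exists v; first by rewrite inE vf; apply/matchedP; exists e.
rewrite /m; case: pickP => [e' /andP [eS' ve']|/(_ e)]; last by rewrite eS ve.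
exact: (matching_inj eS eS' ve ve').
Qed.

Lemma card_nbset_le2 f : (#|nbset S f| <= 2)%N.
Proof.
have [fS|fS] := boolP (f \in S).
  rewrite (_ : nbset S f = set0) ?cards0 //; apply/setP => e; rewrite !inE.
  by apply/negP => /andP [eS]; rewrite S_stable.
apply: leq_trans (card_nbset_matched fS) _.
by rewrite -(card_ends f) subset_leq_card // subsetIl.
Qed.

Lemma card_ends_split f :
  (#|ends f :&: matched| + #|[set v in ends f | v \notin matched]|)%N = 2%N.
Proof.
have -> : [set v in ends f | v \notin matched] = ends f :\: matched.
  by apply/setP => v; rewrite !inE andbC.
by rewrite cardsID card_ends.
Qed.

(** An edge with both ends unmatched would have no neighbour in [S], against maximality. *)
Lemma card_unmatched f : (#|[set v in ends f | v \notin matched]| <= 1)%N.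
Proof.
have [fS|fS] := boolP (f \in S).
  rewrite (_ : [set _ in _ | _] = set0) ?cards0 //; apply/setP => v; rewrite !inE.
  by apply/negP => /andP [vf /negP []]; apply/matchedP; exists f.
have := card_ends_split f; have := card_nbset_matched fS.
by have := nbset_max fS; rewrite -card_gt0; lia.
Qed.

Lemma card_matched f w : w \in ends f -> w \notin matched ->
  #|[set v in ends f | v \in matched]| = 1%N.
Proof.
move=> wf wM; have -> : [set v in ends f | v \in matched] = ends f :&: matched.
  by apply/setP => v; rewrite !inE.
have := card_ends_split f; have := card_unmatched f.
have : (0 < #|[set v in ends f | v \notin matched]|)%N.
  by rewrite card_gt0; apply/set0Pn; exists w; rewrite inE wf.
lia.
Qed.

Lemma nbset_unmatched f w e : w \in ends f -> w \notin matched ->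
  e \in S -> adj e f -> nbset S f = [set e].
Proof.
move=> wf wM eS aef; apply/esym/eqP; rewrite eqEcard sub1set inE eS aef cards1.
rewrite (leq_trans (card_nbset_matched (unmatched_notin wf wM))) //.
by rewrite -(card_matched wf wM) subset_leq_card //.
Qed.

(* Otherwise exchanging [e] for [f] and [g] would enlarge the matching. *)
Lemma no_augmenting_path e f g v v' w w' : e \in S -> v \in ends e -> v' \in ends e ->
  v != v' -> v \in ends f -> w \in ends f -> w \notin matched ->
  v' \in ends g -> w' \in ends g -> w' \notin matched -> w = w'.
Proof.
move=> eS ve ve' vv vf wf wM vg wg wM'; apply/eqP; apply: contraT => ww.
have vM : v \in matched by apply/matchedP; exists e.
have vM' : v' \in matched by apply/matchedP; exists e.
have vw : v != w by apply: contraNneq wM => <-.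
have vw' : v != w' by apply: contraNneq wM' => <-.
have vw2 : v' != w by apply: contraNneq wM => <-.
have vw2' : v' != w' by apply: contraNneq wM' => <-.
have fE := ends_eq vf wf vw; have gE := ends_eq vg wg vw2'.
have afg : adj f g = false.
  rewrite line_adjE; apply/negP => /andP [_ /set0Pn [u]].
  rewrite fE gE !inE => /andP [/orP [] /eqP -> /orP [] /eqP]; apply/eqP => //.
  by rewrite eq_sym.
have adjS h u u' : ends h = [set u; u'] -> u \in ends e -> u' \notin matched ->
    forall d, d \in S :\ e -> adj d h = false.
  move=> hE ue uM d /setD1P [de dS]; rewrite line_adjE.
  apply/negP => /andP [_ /set0Pn [z]]; rewrite hE !inE => /andP [zd /orP []/eqP zu].
    by case/eqP: de; rewrite zu in zd; apply: matching_inj zd ue.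
  by case/negP: uM; apply/matchedP; exists d; rewrite // -zu.
have adjSf := adjS _ _ _ fE ve wM; have adjSg := adjS _ _ _ gE ve' wM'.
have fg : f != g.
  by apply: contraNneq vw' => eqfg; rewrite eqfg gE !inE (negbTE vv) in vf.
have : stable (f |: (g |: (S :\ e))).
  move=> a b /setU1P [->|/setU1P [->|aS]] /setU1P [->|/setU1P [->|bS]].
  - exact: adj_irrefl.
  - exact: afg.
  - by rewrite adj_sym adjSf.
  - by rewrite adj_sym afg.
  - exact: adj_irrefl.
  - by rewrite adj_sym adjSg.
  - exact: adjSf.
  - exact: adjSg.
  - by case/setD1P: aS => _ aS; case/setD1P: bS => _ bS; apply: S_stable.
have gSe : g \notin S :\ e.
  by rewrite inE negb_and (unmatched_notin wg wM') orbT.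
have fSe : f \notin g |: S :\ e.
  by rewrite !inE (negbTE fg) (negbTE (unmatched_notin wf wM)) andbF.
by move/S_max; rewrite cardsU1 fSe cardsU1 gSe (cardsD1 e S) eS !add1n ltnn.
Qed.

(* The unmatched vertices of degree at least 3: at an unmatched vertex of smaller
   degree, [`|star x v| ^+ 2] is absorbed by the term [- 2 * \sum_f `|x f| ^+ 2]
   of [qform_star]. *)
Definition big_unmatched :=
  [set v | (v \notin matched) && (2 < #|[set f : L | v \in ends f]|)%N].

Variable J : {set L}.
Hypothesis J_sub : J \subset S.
Hypothesis J_free : rows_free J.
Hypothesis J_span : rows_span S J.

Lemma nbsum_off x e : e \in S -> nbsum (off S x) e = nbsum x e.
Proof.
move=> eS; rewrite !nbsumE; apply: eq_bigr => f aef; rewrite /off.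
by case: ifP => // fS; rewrite S_stable in aef.
Qed.

Lemma star_off x v : v \notin matched -> star (off S x) v = star x v.
Proof.
move=> vM; apply: eq_bigr => f vf.
by rewrite /off (negbTE (unmatched_notin vf vM)).
Qed.

Lemma sum_star_off x e v v' : e \in S -> v \in ends e -> v' \in ends e ->
  v != v' -> nbsum (off S x) e = 0 ->
  star (off S x) v + star (off S x) v' = 0.
Proof.
move=> eS ve ve' vv n0; have := sum_star (off S x) e.
by rewrite n0 {2}/off eS mulr0 addr0 (ends_eq ve ve' vv) big_setU1 ?inE // big_set1.
Qed.

(* On the kernel of the rows [J], the two endpoint sums of a matching edge are
   opposite, so that one more condition per touched edge kills both. *)
Lemma npos_le_rank :
  (npos L <= #|J| + #|touched S| + #|big_unmatched|)%N.
Proof.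
have endP e : exists v, v \in ends e.
  by apply/set0Pn; rewrite -card_gt0 card_ends.
pose a e := xchoose (endP e).
(* The conditions are the rows [J], the sum off [S] at one chosen end of each touched edge, and the
   sum at each big unmatched vertex. *)
pose b (k : {e | e \in J} + {e | e \in touched S} + {w | w \in big_unmatched}) f : algC :=
  match k with
  | inl (inl e) => (adj (val e) f)%:R
  | inl (inr e) => ((f \notin S) && (a (val e) \in ends f))%:R
  | inr w => (val w \in ends f)%:R
  end.
have -> : (#|J| + #|touched S| + #|big_unmatched|)%N =
  #|{: {e | e \in J} + {e | e \in touched S} + {w | w \in big_unmatched}}|.
  by rewrite !card_sum !card_sig.
apply: (npos_leq (b := b)) => x xb; set y := off S x.
have sum_cond (p : pred L) (z : L -> algC) : \sum_f (p f)%:R * z f = \sum_(f | p f) z f.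
  by rewrite [RHS]big_mkcond; apply: eq_bigr => f _; case: (p f); rewrite ?mul1r ?mul0r.
have y0 : {in S, forall e, nbsum y e = 0}.
  apply: (nbsum_span J_span) => e eJ.
  by rewrite nbsum_off ?(subsetP J_sub) //; apply: (xb (inl (inl (exist _ e eJ)))).
rewrite (qform_off S_stable) => [|e eS _]; last exact: y0.
have matched0 v : v \in matched -> star y v = 0.
  case/matchedP => e eS ve.
  have [et|nt] := boolP (e \in touched S); last first.
    rewrite /star big1 // => f vf; rewrite /y /off; case: ifPn => // fS.
    have fe : e != f by apply: contraNneq fS => <-.
    case/negP: nt; rewrite inE eS; apply/existsP; exists f.
    exact: ends_adj ve vf fe.
  have a0 : star y (a e) = 0.
    have := xb (inl (inr (exist _ e et))).
    rewrite /b /= sum_cond => a0; rewrite -[RHS]a0 /star [LHS]big_mkcond [RHS]big_mkcond.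
    apply: eq_bigr => f _; rewrite /y /off; case: (f \in S) => //=.
    by rewrite if_same.
  have [->//|va] := eqVneq v (a e).
  have := sum_star_off eS ve (xchooseP (endP e)) va (y0 e eS).
  by rewrite -/(a e) a0 addr0.
rewrite qform_star subr_le0 (bigID (mem matched)) /= big1 ?add0r; last first.
  by move=> v /matched0 ->; rewrite normr0 expr0n.
(* A big unmatched vertex contributes zero by the last conditions; any other unmatched vertex lies
   on at most two edges. *)
apply: le_trans (_ : \sum_(v | v \notin matched)
                      2%:R * \sum_(f : L | v \in ends f) `|y f| ^+ 2 <= _).
  apply: ler_sum => v vM.
  have [vb|vb] := boolP (v \in big_unmatched).
    rewrite star_off // [star x v](_ : _ = 0); last first.
      by have := xb (inr (exist _ v vb)); rewrite /b /= sum_cond.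
    by rewrite normr0 expr0n mulr_ge0 ?sumr_ge0 // => f _; rewrite exprn_ge0.
  pose A := [set f : L | v \in ends f].
  have AE (F : L -> algC) : \sum_(f : L | v \in ends f) F f = \sum_(f in A) F f.
    by apply: eq_bigl => f; rewrite inE.
  rewrite /star !AE; apply: norm_sum_card_le2.
  by move: vb; rewrite inE vM /= -leqNgt.
(* Each edge has at most one unmatched end, so it is counted at most once. *)
rewrite -mulr_sumr ler_wpM2l // sum_sum_ends ler_sum // => f _.
have := card_unmatched f; case: #|_| => [|[|]] //= _.
by rewrite mulr0n exprn_ge0.
Qed.

(** Take the vectors supported on [J :|: F], with [F] the edges at the [w] big unmatched vertices.
    As [#|F| >= 3w], imposing one condition per such vertex and per pendant edge leaves dimension at
    least [#|J| + 2w - #|pendant S|]. There the form is at most minus the squared norm of the part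
    off [S]. *)
Lemma rank_le_nneg :
  (#|J| + 2 * #|big_unmatched| <= nneg L + #|pendant S|)%N.
Proof.
pose F := [set f : L | [exists w in big_unmatched, w \in ends f]].
have FP f : reflect (exists2 w, w \in big_unmatched & w \in ends f) (f \in F).
  by rewrite inE; apply: (iffP exists_inP).
have bu w : w \in big_unmatched -> w \notin matched.
  by rewrite inE => /andP [].
have FS f : f \in F -> f \notin S.
  by case/FP => w /bu wM wf; apply: unmatched_notin wf wM.
(* The stars of the big unmatched vertices are disjoint, an edge having at most one unmatched
   end. *)
have cardF : (3 * #|big_unmatched| <= #|F|)%N.
  have -> : (3 * #|big_unmatched| = \sum_(w in big_unmatched) 3)%N.
    by rewrite sum_nat_const mulnC.
  apply: (@leq_trans (\sum_(w in big_unmatched) #|[set f : L | w \in ends f]|)).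
    by apply: leq_sum => w; rewrite inE => /andP [].
  rewrite (eq_bigr (fun w => \sum_(f in F | w \in ends f) 1)%N); last first.
    move=> w wb; rewrite -sum1_card; apply: eq_bigl => f; rewrite inE.
    by rewrite andb_idl // => wf; apply/FP; exists w.
  rewrite (exchange_big_dep (mem F)) /=; last by move=> w f _ /andP [].
  rewrite -[#|F|]sum1_card; apply: leq_sum => f fF.
  rewrite sum1_card; apply: leq_trans (card_unmatched f).
  apply/subset_leq_card/subsetP => w; rewrite inE unfold_in /=.
  by case/andP => /bu -> /andP [_ ->].
have JF : [disjoint J & F].
  rewrite disjoint_subset; apply/subsetP => e eJ; rewrite inE.
  by apply: contraTN (subsetP J_sub e eJ) => /FS.
pose K : finType := ({f | f \notin J :|: F} + {w | w \in big_unmatched}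
  + {e | e \in pendant S})%type.
pose b (k : K) f : algC :=
  match k with
  | inl (inl g) => (f == val g)%:R
  | inl (inr w) => (val w \in ends f)%:R
  | inr e => (adj (val e) f)%:R
  end.
have cardK : #|K| = (#|~: (J :|: F)| + #|big_unmatched| + #|pendant S|)%N.
  rewrite !card_sum !card_sig; congr (_ + _ + _)%N.
  by apply: eq_card => f; rewrite !inE.
suff : (#|L| <= nneg L + #|K|)%N.
  have := cardsC (J :|: F); rewrite cardsU disjoint_setI0 // cards0 subn0.
  by rewrite cardK; move: cardF; clear; lia.
apply: (leq_nneg_ker (b := b)) => x x0 xb; set y := off S x.
have sum_cond (p : pred L) (z : L -> algC) : \sum_f (p f)%:R * z f = \sum_(f | p f) z f.
  by rewrite [RHS]big_mkcond; apply: eq_bigr => f _; case: (p f); rewrite ?mul1r ?mul0r.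
have xJF f : f \notin J :|: F -> x f = 0.
  move=> fJF; have := xb (inl (inl (exist _ f fJF))).
  by rewrite /b /= sum_cond big_pred1_eq.
have yF f : f \notin F -> y f = 0.
  move=> fF; rewrite /y /off; case: ifPn => // fS; apply: xJF.
  by rewrite inE (negbTE fF) orbF; apply: contraNN fS; apply: (subsetP J_sub).
(* If [e] has a neighbour in [F], that neighbour has an unmatched end, hence no other neighbour in
   [S], and [e] is pendant. *)
have y0 : {in S, forall e, nbsum y e = 0}.
  move=> e eS; have [ep|ep] := boolP (e \in pendant S).
    by rewrite nbsum_off //; apply: (xb (inr (exist _ e ep))).
  rewrite nbsumE big1 // => f aef; apply: yF; apply: contraNN ep => /FP [w /bu wM wf].
  by rewrite inE eS; apply/existsP; exists f; rewrite (nbset_unmatched wf wM eS).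
(* If [y] is nonzero on two edges at a matched [v], the absence of augmenting paths makes the star
   sum at the other end [v'] zero, and the sums at [v] and [v'] are opposite. *)
have star_le v : `|star y v| ^+ 2
    <= \sum_(f : L | v \in ends f) (v \in matched)%:R * `|y f| ^+ 2.
  have ge0 : 0 <= \sum_(f : L | v \in ends f) (v \in matched)%:R * `|y f| ^+ 2.
    by apply: sumr_ge0 => f _; rewrite mulr_ge0 ?exprn_ge0.
  have [/matchedP [e eS ve]|vM] := boolP (v \in matched); last first.
    suff -> : star y v = 0 by rewrite normr0 expr0n; move: ge0; rewrite (negbTE vM).
    have [vb|vb] := boolP (v \in big_unmatched).
      by rewrite star_off //; have := xb (inl (inr (exist _ v vb))); rewrite /b /= sum_cond.
    apply: big1 => f vf; apply: yF; apply: contraNN vb => /FP [w wb wf].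
    have := card_unmatched f; rewrite leqNgt; apply: contraNT => vb.
    apply/card_gt1P; exists v, w; rewrite !inE vf wf vM bu //.
    by split=> //; apply: contraNneq vb => ->.
  under eq_bigr do rewrite mul1r.
  have [v' ve' vv] : exists2 v', v' \in ends e & v != v'.
    have : (1 < #|ends e|)%N by rewrite card_ends.
    case/card_gt1P => u [u' [ue ue' uu]].
    by have [->|vu] := eqVneq v u; [exists u' | exists u].
  have [f1 /andP [vf1 yf1]|none] := pickP (fun f : L => (v \in ends f) && (y f != 0)); last first.
    rewrite /star big1 ?normr0 ?expr0n ?sumr_ge0 // => f vf; rewrite ?exprn_ge0 //.
    by have := none f; rewrite vf => /negbFE /eqP.
  have [f2 /and3P [vf2 yf2 ff]|none] :=
      pickP (fun f : L => [&& v \in ends f, y f != 0 & f != f1]); last first.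
    have y1 f : v \in ends f -> f != f1 -> y f = 0.
      by move=> vf ff; have := none f; rewrite vf ff andbT => /negbFE /eqP.
    rewrite /star (bigD1 f1) //= big1 ?addr0; last by move=> f /andP [/y1 yf /yf].
    rewrite (bigD1 f1) //= lerDl sumr_ge0 // => f _.
    by rewrite exprn_ge0.
  have inF f : y f != 0 -> f \in F by apply: contraNT => /yF ->.
  have star0 : star y v' = 0.
    apply: big1 => g vg; apply: contraTeq isT => /inF /FP [w /bu wM wg].
    have /FP [w1 /bu wM1 wf1] := inF _ yf1; have /FP [w2 /bu wM2 wf2] := inF _ yf2.
    have w1E := no_augmenting_path eS ve ve' vv vf1 wf1 wM1 vg wg wM.
    have w2E := no_augmenting_path eS ve ve' vv vf2 wf2 wM2 vg wg wM.
    have vw : v != w by apply: contraNneq wM => <-; apply/matchedP; exists e.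
    rewrite w1E in wf1; rewrite w2E in wf2.
    case/negP: ff; apply/eqP/ends_inj.
    by rewrite (ends_eq vf1 wf1 vw) (ends_eq vf2 wf2 vw).
  have := sum_star_off eS ve ve' vv (y0 e eS); rewrite star0 addr0 => ->.
  by rewrite normr0 expr0n sumr_ge0 // => f _; rewrite exprn_ge0.
(* Each edge of [F] has exactly one matched end. *)
have star_sum : \sum_v `|star y v| ^+ 2 <= \sum_f `|y f| ^+ 2.
  apply: le_trans (ler_sum _ (fun v _ => star_le v)) _.
  rewrite (exchange_big_dep predT) //=; apply: ler_sum => f _.
  rewrite -mulr_suml; have [fF|/yF ->] := boolP (f \in F); last first.
    by rewrite normr0 expr0n mulr0.
  have /FP [w /bu wM wf] := fF.
  rewrite (_ : \sum_(v | _) _ = 1) ?mul1r //.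
  rewrite -[RHS](_ : #|[set v in ends f | v \in matched]|%:R = 1); last first.
    by rewrite (card_matched wf wM).
  rewrite -sum1_card natr_sum big_mkcond [RHS]big_mkcond /=; apply: eq_bigr => v _.
  by rewrite inE; case: (v \in ends f) => //; case: (v \in matched).
have qx : qform x <= - \sum_f `|y f| ^+ 2.
  rewrite (qform_off S_stable) => [|e eS _]; last exact: y0.
  rewrite qform_star mulr_natl mulr2n opprD addrA.
  by rewrite gerDr subr_le0.
have y2 : 0 <= \sum_f `|y f| ^+ 2 by apply: sumr_ge0 => f _; rewrite exprn_ge0.
split; first by rewrite (le_trans qx) // oppr_le0.
move=> q0; move: qx; rewrite q0 oppr_ge0 => y2'.
have /eqP := le_anti (introT andP (conj y2' y2)).
rewrite psumr_eq0 => [/allP yz|f _]; last exact: exprn_ge0.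
apply: (nbsum_free J_free) x0 => f fJ.
have [fF|fF] := boolP (f \in F); last by apply: xJF; rewrite inE negb_or fJ.
have := yz f (mem_index_enum f); rewrite expf_eq0 normr_eq0 /= /y /off.
by rewrite (negbTE (FS f fF)) => /eqP.
Qed.

End LineGraph.

(** * Maximum stable sets and combination of the bounds *)

Lemma max_stable_exists (H : sgraph) : exists2 S : {set H}, stable S &
  forall S' : {set H}, stable S' -> (#|S'| <= #|S|)%N.
Proof.
pose p (S : {set H}) := [forall e in S, forall f in S, ~~ adj e f].
have pP S : reflect (stable S) (p S).
  apply: (iffP forall_inP) => [h e f eS fS|h e eS].
    by apply/negbTE; have /forall_inP -> := h e eS.
  by apply/forall_inP => f fS; rewrite h.
have p0 : p set0 by apply/forall_inP => e; rewrite inE.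
case: (@arg_maxnP _ set0 p (fun S : {set H} => #|S|) p0) => S /pP Sst Smax.
by exists S => // S' /pP; apply: Smax.
Qed.

Lemma inertia_line_graph (G : sgraph) (n := npos (line_graph G))
    (k := nneg (line_graph G)) :
  (n <= 3 * k /\ n * 2 <= k * k.+1)%N.
Proof.
have [S Sst Smax] := max_stable_exists (line_graph G).
have [J [Jsub Jfree Jspan]] := rows_basis_exists S.
have le1 := npos_le_rank Sst Smax Jsub Jspan.
have le2 := rank_le_nneg Sst Smax Jsub Jfree.
have Ssmall := card_nbset_le2 Sst.
have le3 := card_touched_pendant Jsub Jspan Ssmall.
have le4 : (k <= #|J| -> n * 2 <= #|J| * #|J|.+1)%N.
  by apply: (npos_traces Sst Jsub Jfree Jspan (nbset_max Sst Smax) Ssmall).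
have le5 : (#|J| <= k)%N := card_basis_nneg Sst Jsub Jfree.
rewrite -/k -/n in le1 le2.
(* With [r = #|J|] and [h = #|pendant S|], eliminating the other cardinals gives [2n <= 5r + k - h],
   where [r <= k]. *)
split; first by move: le1 le2 le3 le5; clear; lia.
have [kJ|Jk] := leqP k #|J|.
  by apply: leq_trans (le4 kJ) _; rewrite leq_mul.
(* Now [r <= k - 1], so [2n <= 6k - 5], and parity improves this to [6k - 6]. *)
have le6 : (n + 3 <= 3 * k)%N by move: le1 le2 le3 Jk; clear; lia.
(* This is (k - 2) * (k - 3) >= 0. *)
have le7 m : (6 * m <= m * m.+1 + 6)%N by case: m => [|[|[|m]]] //; nia.
by move: (le7 k) le6; clear; lia.
Qed.

Theorem theorem4p11 (G : sgraph) :
  (npos (line_graph G))%:R <=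
    Num.min (3%:R * (nneg (line_graph G))%:R)
            (1 / 2%:R * (nneg (line_graph G))%:R
               * ((nneg (line_graph G))%:R + 1)) :> rat.
Proof.
have [le3k leC] := inertia_line_graph G.
rewrite le_min -natrM ler_nat le3k /=.
rewrite div1r -mulrA ler_pdivlMl ?ltr0n // natr1 -!natrM ler_nat.
by rewrite mulnC.
Qed.
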